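(* Let $(\varrho^s_X,\pi^s)$ be a stationary distribution–policy pair and $(\mathbf X^s,\mathbf U^s)$ a corresponding stationary pair of stochastic processes (i.e. $X^s(k)\sim\varrho^s_X$, and $(X^s(k),U^s(k))$ has the same law as $(X,\pi^s(X))$ for $X\sim\varrho^s_X$). Let $d_D$ be a metric on $\mathcal P_n(\mathcal X)$. Assume that the stochastic optimal control problem is strictly distributionally dissipative at $(\varrho^s_X,\pi^s)$ with respect to $d_D$. Then it has the distributional turnpike property (with respect to $(\mathbf X^s,\mathbf U^s)$) with respect to the same metric $d_D$.
   Context: Setting. $\mathcal X,\mathcal U,\mathcal W$ are separable Banach spaces, $\|\cdot\|$ is the norm of $\mathcal X$, $(\Omega,\mathcal F,\mathbb P)$ is a probability space, $n,l\ge 1$ are fixed exponents, and $L^n(\Omega,\mathcal F,\mathbb P;\mathcal X)$ is the space of $\mathcal X$-valued random variables with finite $n$-th moment. $f:\mathcal X\times\mathcal U\times\mathcal W\to\mathcal X$ is continuous in $(x,u)$ for almost all $w$. $\mathbf W=(W(0),W(1),\dots)$ is a fixed i.i.d. sequence with distribution $\varrho_W$. The control system is $X(k+1)=f(X(k),U(k),W(k))$, $X(0)=X_0$, with $X(k)\in L^n(\Omega,\mathcal F_k,\mathbb P;\mathcal X)$, $U(k)\in L^l(\Omega,\mathcal F_k,\mathbb P;\mathcal U)$, $\mathcal F_k=\sigma(X(0),\dots,X(k))$; it is always required that $W(k)$ is independent of $(X(k),U(k))$. The trajectory is denoted $X_{\mathbf U}(k,X_0)$ or $X(k)$. The constraint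 set $\mathbb Y\subseteq L^n(\Omega,\mathcal F,\mathbb P;\mathcal X)\times L^l(\Omega,\mathcal F,\mathbb P;\mathcal U)$ is law-invariant (if $(X,U)\in\mathbb Y$ and $(Y,V)$ has the same joint law as $(X,U)$, then $(Y,V)\in\mathbb Y$); $\mathbb X:=\{X : \exists U,\ (X,U)\in\mathbb Y\}$. $\mathbb U^N(X_0)$ is the set of admissible control sequences $\mathbf U=(U(0),\dots,U(N-1))$ for $X_0\in\mathbb X$: $U(k)\in L^l(\Omega,\mathcal F_k,\mathbb P;\mathcal U)$, $(X(k),U(k))\in\mathbb Y$ for $k=0,\dots,N-1$, and $X(N)\in\mathbb X$; $\mathbb U^\infty(X_0)$ is defined analogously for infinite sequences ($(X(k),U(k))\in\mathbb Y$ for all $k\in\mathbb N_0$). It is assumed that $\mathbb U^\infty(X_0)\ne\emptyset$ for all $X_0\in\mathbb X$. The stage cost $\ell:\mathbb Y\to\mathbb R$ is law-invariant ($\ell(X,U)$ depends only on the joint law of $(X,U)$). Markov policies. $\Pi_0(\mathcal X,\mathcal U)$ is the set of (measurable) maps $\pi:\mathcal X\to\mathcal U$ with $\pi\circ X\in L^l(\Omega,\mathcal F,\mathbb P;\mathcal U)$ for all $X\in L^n(\Omega,\mathcal F,\mathbb P;\mathcal X)$. $\mathbb F^N(X_0)$ (for $N\in\mathbb N\cup\{\infty\}$) is the set of $\mathbf U\in\mathbb U^N(X_0)$ such that for every $k<N$ there is $\pi_k\in\Pi_0(\mathcal X,\mathcal U)$ with $U(k)=\pi_k(X(k))$. The stochastic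 optimal control problem is to minimize $J_N(X_0,\mathbf U)=\sum_{k=0}^{N-1}\ell(X(k),U(k))$ over $\mathbf U\in\mathbb F^N(X_0)$. Stationarity. $(\mathbf X^s,\mathbf U^s)$ with $X^s(k+1)=f(X^s(k),U^s(k),W(k))$ (same noise $\mathbf W$), $\mathbf U^s\in\mathbb F^\infty(X^s(0))$, is stationary if the laws of $X^s(k)$, of $U^s(k)$ and of $(X^s(k),U^s(k))$ do not depend on $k\in\mathbb N_0$. Then $\ell(\mathbf X^s,\mathbf U^s)$ denotes the $k$-independent value $\ell(X^s(k),U^s(k))$. A pair $(\varrho^s_X,\pi^s)$ with $\varrho^s_X\in\mathcal P_n(\mathcal X)$, $\pi^s\in\Pi_0(\mathcal X,\mathcal U)$ is a stationary distribution–policy pair if $f(X,\pi^s(X),W)\sim\varrho^s_X$ whenever $X\sim\varrho^s_X$ and $W\sim\varrho_W$ are independent. $\mathcal K_\infty$ is the set of continuous, strictly increasing, unbounded $\alpha:[0,\infty)\to[0,\infty)$ with $\alpha(0)=0$. $P_X$ is the law of $X$; $\mathcal P(\mathcal X)$ is the set of Borel probability measures on $\mathcal X$, $\mathcal P_n(\mathcal X)$ the subset of those with finite $n$-th moment. Strict distributional dissipativity at $(\varrho^s_X,\pi^s)$ with respect to $d_D$: there exist $\Lambda:\mathcal P(\mathcal X)\to\mathbb R$ bounded from below and $\alpha\in\mathcal K_\infty$ such that $$\ell(X,\pi(X))-\ell(X',\pi^s(X'))+\Lambda(P_X)-\Lambda(P_{X^+})\ \ge\ \alpha(d_D(P_X,\varrho^s_X))$$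 for all $(X,\pi(X))\in\mathbb Y$ with $\pi\in\Pi_0(\mathcal X,\mathcal U)$ and all $X'\sim\varrho^s_X$, where $P_{X^+}$ is the law of $X^+=f(X,\pi(X),W)$ with $W\sim\varrho_W$ independent of $X$. Distributional turnpike property with respect to $d_D$: there exists $\alpha_3\in\mathcal K_\infty$ such that for each $X_0\in\mathbb X$ there is $C_c>0$ such that for each $\delta>0$, $N\in\mathbb N$, each $\mathbf U\in\mathbb F^N(X_0)$ with $J_N(X_0,\mathbf U)\le\delta+N\ell(\mathbf X^s,\mathbf U^s)$ and each $\varepsilon>0$, $$\#\{k\in\{0,\dots,N\} : d_D(P_{X_{\mathbf U}(k,X_0)},\varrho^s_X)\le\varepsilon\}\ \ge\ N-\frac{\delta+C_c}{\alpha_3(\varepsilon)}.$$ *)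

(* Defs.v *)
From HB Require Import structures.
From mathcomp Require Import all_boot all_order all_algebra finmap.
From mathcomp Require Import all_classical all_reals all_analysis giry.
Import Order.TTheory GRing.Theory Num.Theory.
Import numFieldNormedType.Exports.

Set Implicit Arguments.
Unset Strict Implicit.
Unset Printing Implicit Defensive.

Local Open Scope classical_set_scope.
Local Open Scope ring_scope.

Definition separable (T : topologicalType) : Prop :=
  exists2 D : set T, countable D & dense D.

(* [T] itself, as a measurable space with its Borel sigma-algebra. *)
Notation borel T := (g_sigma_algebraType (@open T)).

Definition class_Kinfty (R : realType) (alpha : R -> R) : Prop :=
  [/\ alpha 0 = 0,
      forall s, 0 <= s -> 0 <= alpha s,
      {within `[0, +oo[, continuous alpha},
      forall s t, 0 <= s -> s < t -> alpha s < alpha t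
    & forall M, exists2 s, 0 <= s & M < alpha s].

Section random_variables.
Context {R : realType} {d} {Omega : measurableType d} (P : probability Omega R).

(* The law of a random variable as an element of [probability T R]; the value
   for a non-measurable map is junk, so the predicates below that compare laws
   all ask for measurability. *)
Definition law {d'} {T : measurableType d'} (x : Omega -> T) : probability T R :=
  if pselect (measurable_fun setT x) is left mx
  then distribution P (mfun_Sub (mem_set mx : x \in mfun)) : probability T R
  else dirac point : probability T R.

(* Library measures are functions on all sets, hence laws are compared with
   [≡μ], i.e. on measurable sets, and not with Leibniz equality. *)
Definition has_law {d'} {T : measurableType d'} (x : Omega -> T)
    (mu : probability T R) : Prop :=
  measurable_fun setT x /\ law x ≡μ mu.

Definition same_law {d'} {T : measurableType d'} (x y : Omega -> T) : Prop :=
  [/\ measurable_fun setT x, measurable_fun setT y & law x ≡μ law y].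

Definition independent_rv {d1 d2} {T1 : measurableType d1}
    {T2 : measurableType d2} (x : Omega -> T1) (y : Omega -> T2) : Prop :=
  forall A B, measurable A -> measurable B ->
    P (x @^-1` A `&` y @^-1` B) = (P (x @^-1` A) * P (y @^-1` B))%E.

Definition mutually_independent {d'} {T : measurableType d'}
    (y : nat -> Omega -> T) : Prop :=
  forall (J : {fset nat}) (B : nat -> set T), (forall i, measurable (B i)) ->
    P (\bigcap_(i in [set` J]) y i @^-1` B i) =
    (\prod_(i <- J) P (y i @^-1` B i))%E.

Definition independent_of_sequence {d1 d2} {T1 : measurableType d1}
    {T2 : measurableType d2} (x : Omega -> T1) (y : nat -> Omega -> T2) : Prop :=
  forall A E, measurable A ->
    <<s \bigcup_i preimage_set_system setT (y i) measurable >> E ->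
    P (x @^-1` A `&` E) = (P (x @^-1` A) * P E)%E.

Definition finite_moment_rv (p : R) (T : normedModType R) : set (Omega -> T) :=
  [set x | measurable_fun setT (x : Omega -> borel T) /\
           (\int[P]_om (`|x om| `^ p)%:E < +oo)%E].

End random_variables.

Definition finite_moment {R : realType} (p : R) (T : normedModType R) :
    set (probability (borel T) R) :=
  [set mu : probability (borel T) R |
     (\int[mu]_(x in [set: borel T]) (`|x : T| `^ p)%:E < +oo)%E].

(* A metric on a set of probability measures, where equality of measures is
   [≡μ]; the values of [dist] outside [S] are irrelevant. *)
Definition metric_on {R : realType} {d} {T : measurableType d}
    (S : set (probability T R))
    (dist : probability T R -> probability T R -> R) : Prop :=
  [/\ forall mu nu, S mu -> S nu -> 0 <= dist mu nu,
      forall mu nu, S mu -> S nu -> (dist mu nu = 0 <-> mu ≡μ nu),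
      forall mu nu, S mu -> S nu -> dist mu nu = dist nu mu
    & forall mu nu xi, S mu -> S nu -> S xi ->
        dist mu xi <= dist mu nu + dist nu xi].

(* The data of the control problem. [constr] is the constraint set Y, and
   [cost] is only meaningful on it. *)
Record control_problem (R : realType) (X U W : completeNormedModType R)
    d (Omega : measurableType d) := ControlProblem {
  prob : probability Omega R ;
  dyn : X -> U -> W -> X ;
  noise_law : probability (borel W) R ;
  noise : nat -> Omega -> W ;
  state_exp : R ;
  ctrl_exp : R ;
  constr : set ((Omega -> X) * (Omega -> U)) ;
  cost : (Omega -> X) -> (Omega -> U) -> R }.

Section control.
Context {R : realType} {X U W : completeNormedModType R}
        {d} {Omega : measurableType d} (pb : control_problem X U W Omega).

Local Notation P := (prob pb).
Local Notation f := (dyn pb).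
Local Notation Ln := (finite_moment_rv P (state_exp pb) (T := X)).
Local Notation Ll := (finite_moment_rv P (ctrl_exp pb) (T := U)).
Local Notation lawX x := (law P (x : Omega -> borel X)).

Definition pair_rv (x : Omega -> X) (u : Omega -> U) :
  Omega -> (borel X * borel U)%type := fun om => (x om, u om).

Definition feasible_state : set (Omega -> X) :=
  [set x | exists u, constr pb (x, u)].

Fixpoint traj (x0 : Omega -> X) (u : nat -> Omega -> U) (k : nat) : Omega -> X :=
  if k is j.+1 then fun om => f (traj x0 u j om) (u j om) (noise pb j om) else x0.

(* sigma(X(0), ..., X(k)) *)
Definition filtration (x : nat -> Omega -> X) (k : nat) : set (set Omega) :=
  g_sigma_preimage (fun i : 'I_k.+1 => (x i : Omega -> borel X)).

Definition admissible_at (x0 : Omega -> X) (u : nat -> Omega -> U) (k : nat) :=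
  [/\ Ll (u k),
      forall B : set (borel U), measurable B ->
        filtration (traj x0 u) k (u k @^-1` B),
      constr pb (traj x0 u k, u k)
    & independent_rv P (pair_rv (traj x0 u k) (u k))
        (noise pb k : Omega -> borel W)].

(* U^N(X0) and U^oo(X0); only the first N entries of the control sequence matter. *)
Definition admissible (N : nat) (x0 : Omega -> X) : set (nat -> Omega -> U) :=
  [set u | (forall k, (k < N)%N -> admissible_at x0 u k) /\
           feasible_state (traj x0 u N)].

Definition admissible_inf (x0 : Omega -> X) : set (nat -> Omega -> U) :=
  [set u | forall k, admissible_at x0 u k].

Definition policy : set (X -> U) :=
  [set pi | measurable_fun setT (pi : borel X -> borel U) /\
            forall x, Ln x -> Ll (pi \o x)].

(* U(k) and pi_k(X(k)) agree as elements of L^p, i.e. almost surely. *)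
Definition markov_at (x0 : Omega -> X) (u : nat -> Omega -> U) (k : nat) :=
  exists2 pi, policy pi & {ae P, forall om, u k om = pi (traj x0 u k om)}.

Definition markov_ctrl (N : nat) (x0 : Omega -> X) : set (nat -> Omega -> U) :=
  [set u | admissible N x0 u /\ forall k, (k < N)%N -> markov_at x0 u k].

Definition markov_ctrl_inf (x0 : Omega -> X) : set (nat -> Omega -> U) :=
  [set u | admissible_inf x0 u /\ forall k, markov_at x0 u k].

Definition total_cost (N : nat) (x0 : Omega -> X) (u : nat -> Omega -> U) : R :=
  \sum_(k < N) cost pb (traj x0 u k) (u k).

(* In [sa_nonempty] the initial state is independent of the noise: since
   admissible controls keep (X(k), U(k)) independent of W(k), a feasible state
   that depends on the noise can have no admissible control at all. *)
Record standing_assumptions : Prop := StandingAssumptions {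
  sa_sepX : separable X ;
  sa_sepU : separable U ;
  sa_sepW : separable W ;
  sa_state_exp : 1 <= state_exp pb ;
  sa_ctrl_exp : 1 <= ctrl_exp pb ;
  sa_continuous :
    {ae noise_law pb, forall w : W, continuous (fun z : X * U => f z.1 z.2 w)} ;
  sa_noise_law : forall k, has_law P (noise pb k : Omega -> borel W) (noise_law pb) ;
  sa_noise_indep : mutually_independent P (fun k => noise pb k : Omega -> borel W) ;
  sa_constr_sub : forall x u, constr pb (x, u) -> Ln x /\ Ll u ;
  sa_constr_law : forall x u y v, constr pb (x, u) ->
    same_law P (pair_rv x u) (pair_rv y v) -> constr pb (y, v) ;
  sa_cost_law : forall x u y v, constr pb (x, u) -> constr pb (y, v) ->
    same_law P (pair_rv x u) (pair_rv y v) -> cost pb x u = cost pb y v ;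
  sa_nonempty : forall x0, feasible_state x0 ->
    independent_of_sequence P (x0 : Omega -> borel X)
      (fun k => noise pb k : Omega -> borel W) ->
    admissible_inf x0 !=set0 }.

(* [xp] is a version of f(x, pi(x), W) with W ~ noise_law independent of x. *)
Definition closed_loop_successor (pi : X -> U) (x xp : Omega -> X) : Prop :=
  measurable_fun setT (xp : Omega -> borel X) /\
  exists w : Omega -> W,
    [/\ has_law P (w : Omega -> borel W) (noise_law pb),
        independent_rv P (x : Omega -> borel X) (w : Omega -> borel W)
      & {ae P, forall om, xp om = f (x om) (pi (x om)) (w om)}].

Definition stationary_pair (rho : probability (borel X) R) (pi : X -> U) : Prop :=
  [/\ finite_moment (state_exp pb) rho, policy pi
    & forall x xp : Omega -> X, has_law P (x : Omega -> borel X) rho ->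
        closed_loop_successor pi x xp -> has_law P (xp : Omega -> borel X) rho].

Definition stationary_process (xs : nat -> Omega -> X) (us : nat -> Omega -> U) :=
  [/\ forall k, {ae P, forall om,
        xs k.+1 om = f (xs k om) (us k om) (noise pb k om)},
      markov_ctrl_inf (xs 0%N) us,
      forall j k, same_law P (xs j : Omega -> borel X) (xs k),
      forall j k, same_law P (us j : Omega -> borel U) (us k)
    & forall j k, same_law P (pair_rv (xs j) (us j)) (pair_rv (xs k) (us k))].

Definition corresponds_to (rho : probability (borel X) R) (pi : X -> U)
    (xs : nat -> Omega -> X) (us : nat -> Omega -> U) : Prop :=
  forall k, has_law P (xs k : Omega -> borel X) rho /\
    forall x : Omega -> X, has_law P (x : Omega -> borel X) rho ->
      same_law P (pair_rv (xs k) (us k)) (pair_rv x (pi \o x)).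

Definition strictly_dissipative (rho : probability (borel X) R) (pis : X -> U)
    (dist : probability (borel X) R -> probability (borel X) R -> R) : Prop :=
  (* As a function on measures, Lambda respects [≡μ]. *)
  exists (Lambda : probability (borel X) R -> R) (alpha : R -> R),
    [/\ forall mu nu : probability (borel X) R, mu ≡μ nu -> Lambda mu = Lambda nu,
        exists M, forall mu, M <= Lambda mu,
        class_Kinfty alpha
      & forall (pi : X -> U) (x xp x' : Omega -> X),
          policy pi -> constr pb (x, pi \o x) ->
          closed_loop_successor pi x xp ->
          has_law P (x' : Omega -> borel X) rho ->
          cost pb x (pi \o x) - cost pb x' (pis \o x')
            + Lambda (lawX x) - Lambda (lawX xp)
          >= alpha (dist (lawX x) rho)].

Definition turnpike (xs : nat -> Omega -> X) (us : nat -> Omega -> U)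
    (rho : probability (borel X) R)
    (dist : probability (borel X) R -> probability (borel X) R -> R) : Prop :=
  exists2 alpha3 : R -> R, class_Kinfty alpha3 &
  forall x0, feasible_state x0 ->
  exists2 Cc : R, 0 < Cc &
  forall (delta : R) (N : nat) (u : nat -> Omega -> U), 0 < delta ->
    markov_ctrl N x0 u ->
    total_cost N x0 u <= delta + N%:R * cost pb (xs 0%N) (us 0%N) ->
  forall epsilon : R, 0 < epsilon ->
    #|[set k : 'I_N.+1 | dist (lawX (traj x0 u k)) rho <= epsilon]%SET|%:R
      >= N%:R - (delta + Cc) / alpha3 epsilon.

End control.

(* Main.v *)
Require Import Defs.
From HB Require Import structures.
From mathcomp Require Import all_boot all_order all_algebra.
From mathcomp Require Import all_classical all_reals all_analysis.
From mathcomp Require Import measurable_realfun giry lra.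
Import Order.TTheory GRing.Theory Num.Theory.
Import numFieldNormedType.Exports.

(** A turnpike bound is a telescoping argument.  Along a Markov trajectory the
    dissipation inequality can be applied at every time k: the next state is a
    closed-loop successor of X(k), because W(k) is independent of X(k) and U(k)
    is a policy evaluated at X(k) ([markov_dissipation]).  Summing over k < N
    cancels the inner storage terms, so that

      sum_(k < N) alpha (d (P_X(k), rho))
        <= J_N - N * l (Xs, Us) + Lambda (P_X(0)) - Lambda (P_X(N))
        <= delta + Lambda (P_X(0)) - inf Lambda.

    The right-hand side does not depend on N, the control or the radius.  Each
    time k at which d (P_X(k), rho) exceeds epsilon contributes at least
    alpha epsilon to the left-hand side, so a Markov-type count
    ([card_ord_le_ge]) bounds the number of such times, with the dissipativity
    gain alpha itself as the turnpike gain.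

    The remaining work is to pass between almost surely equal controls: U(k)
    equals pi_k (X(k)) only almost surely, but then the two state-control pairs
    have the same law ([ae_eq_same_law]), and both the constraint set and the
    stage cost are invariant under equality of laws
    ([same_law_constr_cost]). *)

Set Implicit Arguments.
Unset Strict Implicit.
Unset Printing Implicit Defensive.

Local Open Scope classical_set_scope.
Local Open Scope ring_scope.

Section laws.
Context {R : realType} {d} {Omega : measurableType d} (P : probability Omega R).

Lemma lawE {d'} {T : measurableType d'} (x : Omega -> T) (A : set T) :
  measurable_fun setT x -> law P x A = P (x @^-1` A).
Proof. by rewrite /law => mx; case: pselect => // mx'. Qed.

(** The probability of an event is the integral of its indicator, which does not
    see null sets. *)
Lemma ae_eq_same_law {d'} {T : measurableType d'} (x y : Omega -> T) :
  measurable_fun setT x -> measurable_fun setT y ->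
  {ae P, forall om, x om = y om} -> same_law P x y.
Proof.
move=> mx my xy; split=> // A mA.
change (law P x A = law P y A); rewrite !lawE//.
have mpre (z : Omega -> T) : measurable_fun setT z -> measurable (z @^-1` A).
  by move=> mz; rewrite -[_ @^-1` _]setTI; exact: mz.
have integral_pre (z : Omega -> T) : measurable_fun setT z ->
    P (z @^-1` A) = (\int[P]_om (\1_(z @^-1` A) om)%:E)%E.
  by move=> mz; rewrite integral_indic ?setIT//; exact: mpre.
rewrite !integral_pre//; apply: ae_eq_integral => //.
- by apply: measurableT_comp => //; apply: measurable_indic; exact: mpre.
- by apply: measurableT_comp => //; apply: measurable_indic; exact: mpre.
- apply: filterS xy => om xyom _; rewrite !indicE.
  by congr ((nat_of_bool _)%:R%:E); apply/idP/idP; rewrite !inE /= xyom.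
Qed.

Lemma measurable_borel_norm (V : normedModType R) :
  measurable_fun setT (fun v : borel V => `|v : V|).
Proof.
apply: (measurability _ (RGenOpens.measurableE R)).
move=> _ [_ [a [b ->] <-]]; rewrite setTI; apply: sub_sigma_algebra.
have /continuousP := @norm_continuous R V; apply.
exact: interval_open.
Qed.

(** The distance is only known to be nonnegative between laws with a finite
    moment; this puts the laws of the states among them. *)
Lemma finite_moment_law (p : R) (V : normedModType R) (x : Omega -> V) :
  finite_moment_rv P p x ->
  finite_moment p (law P (x : Omega -> borel V)).
Proof.
move=> [mx xp]; rewrite /finite_moment /= /law; case: pselect => // mx'.
rewrite ge0_integral_distribution//.
apply: measurableT_comp => //.
exact: (measurableT_comp (measurable_powR p) (measurable_borel_norm (V := V))).
Qed.

End laws.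

(** Each index with [D k > e] carries at least [c] of the sum of [F], so there
    are at most [S / c] of them below [N].  The set on the right also ranges
    over the index [N], where nothing is known about [D]; the bound therefore
    starts from [N] rather than [N + 1]. *)
Lemma card_ord_le_ge (R : realType) (N : nat) (D F : nat -> R) (e c S : R) :
  0 < c -> (forall k, (k < N)%N -> 0 <= F k) ->
  (forall k, (k < N)%N -> e < D k -> c <= F k) ->
  \sum_(k < N) F k <= S ->
  N%:R - S / c <= #|[set k : 'I_N.+1 | D k <= e]%SET|%:R.
Proof.
move=> c0 F0 cF FS.
rewrite -sum1dep_card natr_sum big_mkcond big_ord_recr /=.
apply: (@le_trans _ _ (\sum_(k < N) if D k <= e then 1 else 0)); last first.
  by rewrite lerDl; case: ifP.
rewrite lerBlDr -lerBlDl ler_pdivlMr// (le_trans _ FS)//.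
rewrite -[in N%:R](card_ord N) -sum1_card natr_sum -sumrB mulr_suml.
apply: ler_sum => k _; case: (leP (D k) e) => [_|eDk].
  by rewrite subrr mul0r F0.
by rewrite subr0 mul1r cF.
Qed.

Section turnpike.
Context {R : realType} {X U W : completeNormedModType R}
        {d} {Omega : measurableType d} (pb : control_problem X U W Omega).
Hypothesis sa : standing_assumptions pb.

Local Notation P := (prob pb).

Lemma constr_measurable x u : constr pb (x, u) ->
  measurable_fun setT (x : Omega -> borel X) /\
  measurable_fun setT (u : Omega -> borel U).
Proof. by move=> /(sa_constr_sub sa)[[mx _] [mu _]]. Qed.

(** Law invariance of the constraint set has to come first: the stage cost is
    law-invariant only between pairs that both satisfy the constraints. *)
Lemma same_law_constr_cost x u y v : constr pb (x, u) ->
  same_law P (pair_rv x u) (pair_rv y v) ->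
  constr pb (y, v) /\ cost pb x u = cost pb y v.
Proof.
move=> cxu xuyv; have cyv := sa_constr_law sa cxu xuyv.
by split=> //; exact: (sa_cost_law sa).
Qed.

Lemma ae_policy_constr_cost x u pi : constr pb (x, u) -> policy pb pi ->
  {ae P, forall om, u om = pi (x om)} ->
  constr pb (x, pi \o x) /\ cost pb x u = cost pb x (pi \o x).
Proof.
move=> cxu [mpi _] upi; have [mx mu] := constr_measurable cxu.
apply: same_law_constr_cost => //; apply: ae_eq_same_law.
- exact: measurable_fun_pair.
- apply: measurable_fun_pair => //.
  exact: (@measurableT_comp _ _ _ _ (borel X) (borel U)).
- by apply: filterS upi => om uom; rewrite /pair_rv uom.
Qed.

Lemma admissible_constr N x0 u k : admissible pb N x0 u -> (k <= N)%N ->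
  exists v, constr pb (traj pb x0 u k, v).
Proof.
move=> [adm feasN]; rewrite leq_eqVlt => /orP[/eqP->//|/adm[_ _ ? _]].
by exists (u k).
Qed.

(** Independence of W(k) from the pair (X(k), U(k)) passes to X(k) alone, by
    testing on cylinders.  The next state is measurable because the trajectory
    is still feasible at time k + 1, even when that is the final time. *)
Lemma markov_closed_loop N x0 u k pi : admissible pb N x0 u -> (k < N)%N ->
  {ae P, forall om, u k om = pi (traj pb x0 u k om)} ->
  closed_loop_successor pb pi (traj pb x0 u k) (traj pb x0 u k.+1).
Proof.
move=> adm kN upi; split.
  by have [v /constr_measurable[]] := admissible_constr adm kN.
exists (noise pb k); split.
- exact: sa_noise_law sa k.
- have [_ _ _ ind] := adm.1 _ kN.
  move=> A B mA mB.
  have := ind (A `*` setT) B (measurableX mA measurableT) mB.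
  suff -> : pair_rv (traj pb x0 u k) (u k) @^-1` (A `*` setT) =
    traj pb x0 u k @^-1` A by [].
  by apply/seteqP; split=> om //= -[].
- by apply: filterS upi => om /= ->.
Qed.

Section dissipative.
Variables (rho : probability (borel X) R) (pis : X -> U).
Variables (xs : nat -> Omega -> X) (us : nat -> Omega -> U).
Hypothesis stat : stationary_process pb xs us.
Hypothesis corr : corresponds_to pb rho pis xs us.

(** Dissipativity compares with the cost of the stationary policy, the turnpike
    property with that of the stationary process; the two pairs have one law. *)
Lemma stationary_cost :
  cost pb (xs 0%N) (pis \o xs 0%N) = cost pb (xs 0%N) (us 0%N).
Proof.
have [_ [adm _] _ _ _] := stat.
have [_ _ cs _] := adm 0%N.
have [lxs sxs] := corr 0%N.
by have [_ ->] := same_law_constr_cost cs (sxs _ lxs).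
Qed.

Variables (Lambda : probability (borel X) R -> R) (gain : R -> R).
Variable dist : probability (borel X) R -> probability (borel X) R -> R.
Hypothesis diss : forall (pi : X -> U) (x xp x' : Omega -> X),
  policy pb pi -> constr pb (x, pi \o x) ->
  closed_loop_successor pb pi x xp ->
  has_law P (x' : Omega -> borel X) rho ->
  cost pb x (pi \o x) - cost pb x' (pis \o x')
    + Lambda (law P (x : Omega -> borel X))
    - Lambda (law P (xp : Omega -> borel X))
  >= gain (dist (law P (x : Omega -> borel X)) rho).

(** The almost sure policy representation of U(k) is replaced by an exact one
    with the same cost before the dissipation inequality is applied. *)
Lemma markov_dissipation N x0 u k : markov_ctrl pb N x0 u -> (k < N)%N ->
  gain (dist (law P (traj pb x0 u k : Omega -> borel X)) rho) <=
  cost pb (traj pb x0 u k) (u k) - cost pb (xs 0%N) (us 0%N)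
    + Lambda (law P (traj pb x0 u k : Omega -> borel X))
    - Lambda (law P (traj pb x0 u k.+1 : Omega -> borel X)).
Proof.
move=> [adm mk] kN; have [pi ppi upi] := mk _ kN.
have [_ _ cxu _] := adm.1 _ kN.
have [cxpi ->] := ae_policy_constr_cost cxu ppi upi.
rewrite -stationary_cost; apply: diss => //.
- exact: markov_closed_loop adm kN upi.
- exact: (corr 0%N).1.
Qed.

Lemma sum_gain_le N x0 u : markov_ctrl pb N x0 u ->
  \sum_(k < N) gain (dist (law P (traj pb x0 u k : Omega -> borel X)) rho) <=
  total_cost pb N x0 u - N%:R * cost pb (xs 0%N) (us 0%N)
    + Lambda (law P (x0 : Omega -> borel X))
    - Lambda (law P (traj pb x0 u N : Omega -> borel X)).
Proof.
move=> mk.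
pose L k := Lambda (law P (traj pb x0 u k : Omega -> borel X)).
pose c := cost pb (xs 0%N) (us 0%N).
rewrite -/(L 0%N) -/(L N) -/c.
have -> : total_cost pb N x0 u - N%:R * c + L 0%N - L N =
    \sum_(k < N) (cost pb (traj pb x0 u k) (u k) - c + L k - L k.+1).
  under eq_bigr do rewrite -addrA.
  rewrite big_split /= sumrB sumr_const card_ord mulr_natl -addrA.
  congr (_ + _); rewrite -[RHS]opprK -sumrN.
  under eq_bigr do rewrite opprB.
  by rewrite -(big_mkord xpredT (fun k => L k.+1 - L k)) telescope_sumr// opprB.
by apply: ler_sum => k _; exact: markov_dissipation mk (ltn_ord k).
Qed.

End dissipative.
End turnpike.

Theorem mainTheorem10 (R : realType) (X U W : completeNormedModType R)
    (d : measure_display) (Omega : measurableType d)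
    (pb : control_problem X U W Omega)
    (rho : probability (borel X) R) (pis : X -> U)
    (xs : nat -> Omega -> X) (us : nat -> Omega -> U)
    (dist : probability (borel X) R -> probability (borel X) R -> R) :
  standing_assumptions pb ->
  stationary_pair pb rho pis ->
  stationary_process pb xs us ->
  corresponds_to pb rho pis xs us ->
  metric_on (@finite_moment R (state_exp pb) X) dist ->
  strictly_dissipative pb rho pis dist ->
  turnpike pb xs us rho dist.
Proof.
move=> sa [rho_fin _ _] stat corr [dist_ge0 _ _ _]
  [Lambda [gain [_ [M LambdaM] Kgain diss]]].
exists gain => // x0 _.
have [gain0 gain_ge0 _ gain_incr _] := Kgain.
pose L0 := Lambda (law (prob pb) (x0 : Omega -> borel X)).
(* L0 - M is only nonnegative, and the turnpike constant must be positive. *)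
exists (L0 - M + 1).
  by rewrite ltr_wpDl// subr_ge0; exact: LambdaM.
move=> delta N u delta0 mk costN e e0.
pose D k := dist (law (prob pb) (traj pb x0 u k : Omega -> borel X)) rho.
apply: (@card_ord_le_ge _ _ D (gain \o D)).
- by rewrite -gain0; exact: gain_incr.
- move=> k kN; apply: gain_ge0; apply: dist_ge0 => //.
  apply: finite_moment_law.
  by have [_ _ /(sa_constr_sub sa)[]] := mk.1.1 _ kN.
- by move=> k kN eD; apply: ltW; apply: gain_incr => //; exact: ltW.
apply: (le_trans
  (sum_gain_le (gain := gain) (dist := dist) sa stat corr diss mk)).
rewrite addrAC -/L0.
have MN := LambdaM (law (prob pb) (traj pb x0 u N : Omega -> borel X)).
lra.
Qed.
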